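(* Let $\gamma(z;\mu)$ be the Mellin-space DGLAP kernel of QCD (as described in the context), and let $\mathcal K$ and $\mathcal K'$ be two scheme transformations that map $\gamma$ to the same transformed kernel, i.e. $$\mathcal K\gamma\mathcal K^{-1}+\Big(\frac{d\mathcal K}{d\ln\mu^2}\Big)\mathcal K^{-1}=\mathcal K'\gamma\mathcal K'^{-1}+\Big(\frac{d\mathcal K'}{d\ln\mu^2}\Big)\mathcal K'^{-1}$$ at every Mellin moment $z$. Then $\mathcal K=\mathcal K'$ at every moment. In other words, the map $\mathcal K\mapsto(\gamma\Rightarrow\gamma^{(s)})$ that sends a scheme transformation to its action on the kernel is injective.
   Context: **Flavor space.** The space of dimension $2N_f+1$ ($N_f\geqslant1$) with basis labelled by quarks $q_i$, antiquarks $\bar q_i$ ($i=1,\dots,N_f$) and the gluon $g$. $C$ is the matrix exchanging $q_i\leftrightarrow\bar q_i$ and fixing $g$. $S_{N_f}$ permutes flavors simultaneously on quarks and antiquarks. $G=\langle C\rangle\times S_{N_f}$. Set $\Sigma_\pm=\sum_i(q_i\pm\bar q_i)$. Under $G$ flavor space decomposes into the plane $\{\Sigma_+,g\}$ (two copies of the trivial representation), the $C$-odd singlet $\Sigma_-$, and the traceless parts of $q_i+\bar q_i$ and of $q_i-\bar q_i$ (absent for $N_f=1$). **Coupling.** $a_s(\mu)>0$ runs by $da_s/d\ln\mu^2=\beta(a_s)=-\beta_0a_s^2-\beta_1a_s^3-\cdots$, with $\beta_0=11-\tfrac23N_f>0$, so $a_s\to0$ as $\mu\to\infty$. **Kernel.**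 $\gamma(z;\mu)=\sum_{k\geqslant1}a_s^k(\mu)\gamma^{[k]}(z)$, where $z\in\mathbb C$ is the Mellin moment. It commutes with $G$ at every $z$, so it is a $2\times2$ block on $\{\Sigma_+,g\}$ and a scalar on each of the other three sectors. *Leading-order QCD kernel* (with $C_F=4/3$, $C_A=3$, $T_R=1/2$, $S_1(z)=\psi(z+1)+\gamma_E$): on all three scalar sectors $\gamma^{[1]}$ equals $\gamma^{[1]}_{qq}(z)=2C_F\big[\tfrac32+\tfrac1{z(z+1)}-2S_1(z)\big]$. On $(\Sigma_+,g)$ it is $\begin{pmatrix}\gamma_{qq}^{[1]}&\gamma_{qg}^{[1]}\\ \gamma_{gq}^{[1]}&\gamma_{gg}^{[1]}\end{pmatrix}$ with $\gamma_{qg}^{[1]}=4N_fT_R\frac{z^2+z+2}{z(z+1)(z+2)}$, $\gamma_{gq}^{[1]}=2C_F\frac{z^2+z+2}{(z-1)z(z+1)}$, $\gamma_{gg}^{[1]}=4C_A\big[\tfrac1{z(z-1)}+\tfrac1{(z+1)(z+2)}-S_1(z)\big]+\beta_0$. **Scheme transformation.** A $(2N_f+1)\times(2N_f+1)$ matrix $\mathcal K(z;\mu)$ on flavor space such that: it is invertible and differentiable in $\mu$ at every Mellin moment; it is analytic in $z$ (on a right half-plane) with $\mathcal K(\bar z;\mu)=\overline{\mathcal K(z;\mu)}$; it acts on densities by $\overline f^{(s)}=\mathcal K\overline f$ and on kernels by $\gamma^{(s)}=\mathcal K\gamma\mathcal K^{-1}+\big(\tfrac{d\mathcal K}{d\ln\mu^2}\big)\mathcal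 K^{-1}$; and it approaches the identity perturbatively as $\mu\to\infty$, meaning $\mathcal K=1+\sum_{k\geqslant1}a_s^k(\mu)\kappa_k(z)$ as a power series in $a_s$ with coefficients analytic in $z$ (statements are understood perturbatively, for such series). *)

(* Defs.v *)
From mathcomp Require Import all_boot all_order all_algebra all_fingroup.
From mathcomp Require Import complex zify.
From mathcomp Require Import all_classical all_reals all_analysis.

Set Implicit Arguments.
Unset Strict Implicit.
Unset Printing Implicit Defensive.

Import Order.TTheory GRing.Theory Num.Theory.
Import numFieldNormedType.Exports.

Local Open Scope ring_scope.
Local Open Scope classical_set_scope.
Local Open Scope complex_scope.

(* A formal power series in the coupling, f = \sum_n a^n f_n, is the sequence
   n |-> f_n of its coefficients. *)
Section FormalSeries.
Variable A : pzRingType.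
Implicit Types f g h : nat -> A.

Definition fps_one : nat -> A := fun n => (n == 0%N)%:R.

Definition fps_add f g : nat -> A := fun n => f n + g n.

Definition fps_mul f g : nat -> A := fun n => \sum_(j < n.+1) f j * g (n - j)%N.

Definition fps_exp f (k : nat) : nat -> A := iter k (fps_mul f) fps_one.

(* Inverse of a series with constant term 1: the Neumann series
   \sum_k (1 - f)^k, a finite sum in each degree since (1 - f)^k = O(a^k). *)
Definition fps_inv f : nat -> A :=
  fun n => \sum_(k < n.+1) fps_exp (fun m => fps_one m - f m) k n.

Lemma fps_mulA f g h n :
  fps_mul f (fps_mul g h) n = fps_mul (fps_mul f g) h n.
Proof.
rewrite /fps_mul; transitivity
  (\sum_(j < n.+1) \sum_(k < n.+1 | (k <= n - j)%N)
      f j * (g (n - j - k)%N * h k)).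
  apply: eq_bigr => j _; rewrite big_distrr /=.
  rewrite (big_ord_narrow_leq (F := fun k => f j * (g (n - j - k)%N * h k))
             (leq_subr _ _)).
  rewrite (reindex_inj rev_ord_inj) /=; apply: eq_bigr => k _.
  by rewrite subSS subKn // -ltnS.
transitivity
  (\sum_(k < n.+1) \sum_(j < n.+1 | (j <= n - k)%N)
      (f j * g (n - k - j)%N) * h k).
  rewrite (exchange_big_dep predT) //=; apply: eq_bigr => k _.
  have nk (j : 'I_n.+1) : (k <= n - j)%N = (j <= n - k)%N.
    have jn : (j <= n)%N by rewrite -ltnS.
    have kn : (k <= n)%N by rewrite -ltnS.
    by rewrite leq_subRL // addnC -leq_subRL.
  rewrite (eq_bigl _ _ nk); apply: eq_bigr => j _.
  by rewrite mulrA -!subnDA addnC.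
rewrite [RHS](reindex_inj rev_ord_inj) /=; apply: eq_bigr => k _.
have kn : (k <= n)%N by rewrite -ltnS.
rewrite (big_ord_narrow_leq (F := fun j => (f j * g (n - k - j)%N) * h k)
           (leq_subr _ _)) subSS subKn // big_distrl /=.
by apply: eq_bigr => j _.
Qed.

Lemma eq_fps_mul f f' g g' : f =1 f' -> g =1 g' -> fps_mul f g =1 fps_mul f' g'.
Proof.
by move=> ef eg n; apply: eq_bigr => j _; rewrite ef eg.
Qed.

Lemma fps_mul1 f : fps_mul fps_one f =1 f.
Proof.
move=> n; rewrite /fps_mul big_ord_recl /= subn0 mul1r.
by rewrite big1 ?addr0 // => j _; rewrite mul0r.
Qed.

Lemma fps_mulr1 f : fps_mul f fps_one =1 f.
Proof.
move=> n; rewrite /fps_mul big_ord_recr /= subnn mulr1.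
rewrite big1 ?add0r // => j _.
by rewrite /fps_one subn_eq0 leqNgt ltn_ord mulr0.
Qed.

Lemma fps_expSr f k : fps_exp f k.+1 =1 fps_mul (fps_exp f k) f.
Proof.
elim: k => [|k IHk] n; first by rewrite /= fps_mul1 fps_mulr1.
rewrite [LHS](eq_fps_mul (frefl _) IHk).
by rewrite fps_mulA.
Qed.

Lemma fps_exp_low f k n : f 0%N = 0 -> (n < k)%N -> fps_exp f k n = 0.
Proof.
move=> f0; elim: k n => [//|k IHk] n nk /=.
rewrite /fps_mul big1 // => -[[|j] /= jn] _; first by rewrite f0 mul0r.
by rewrite IHk ?mulr0 //; lia.
Qed.

Lemma fps_inv_wide f n m : f 0%N = 1 -> (n <= m)%N ->
  fps_inv f n = \sum_(k < m.+1) fps_exp (fun i => fps_one i - f i) k n.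
Proof.
move=> f0 nm; rewrite /fps_inv.
rewrite (big_ord_widen m.+1
  (fun k => fps_exp (fun i => fps_one i - f i) k n)) // big_mkcond /=.
apply: eq_bigr => k _; case: ifP => // /negbT; rewrite -leqNgt => nk.
by rewrite fps_exp_low // f0 /fps_one eqxx subrr.
Qed.

Lemma fps_mulV f : f 0%N = 1 -> fps_mul f (fps_inv f) =1 fps_one.
Proof.
move=> f0 n; set h := fun i => fps_one i - f i.
have -> : fps_mul f (fps_inv f) n =
    fps_mul fps_one (fps_inv f) n - fps_mul h (fps_inv f) n.
  rewrite -sumrB; apply: eq_bigr => j _.
  by rewrite -mulrBl /h opprB addrCA subrr addr0.
rewrite fps_mul1 (fps_inv_wide f0 (leqnSn n)).
have -> : fps_mul h (fps_inv f) n = \sum_(k < n.+1) fps_exp h k.+1 n.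
  rewrite /= /fps_mul exchange_big /=; apply: eq_bigr => j _.
  by rewrite -mulr_sumr -fps_inv_wide // leq_subr.
by rewrite big_ord_recl /= addrK.
Qed.

Lemma fps_mulVr f : f 0%N = 1 -> fps_mul (fps_inv f) f =1 fps_one.
Proof.
move=> f0 n; set h := fun i => fps_one i - f i.
have -> : fps_mul (fps_inv f) f n =
    fps_mul (fps_inv f) fps_one n - fps_mul (fps_inv f) h n.
  rewrite -sumrB; apply: eq_bigr => j _.
  by rewrite -mulrBr /h opprB addrCA subrr addr0.
rewrite fps_mulr1 (fps_inv_wide f0 (leqnSn n)).
have -> : fps_mul (fps_inv f) h n = \sum_(k < n.+1) fps_exp h k.+1 n.
  under [RHS]eq_bigr => k _ do rewrite fps_expSr.
  rewrite /fps_mul exchange_big /=; apply: eq_bigr => j _.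
  by rewrite -mulr_suml -(@fps_inv_wide f j n f0) // -ltnS.
by rewrite big_ord_recl /= addrK.
Qed.

End FormalSeries.

Section SpecialFunctions.
Variable R : realType.
Local Notation C := R[i].

Definition cexp (z : C) : C :=
  (expR (complex.Re z) * cos (complex.Im z)) +i*
  (expR (complex.Re z) * sin (complex.Im z)).

(* Euler's limit n! n^z / (z (z+1) ... (z+n)), valid on all of C except for the
   poles 0, -1, -2, ...; the type R[i]^o carries the usual topology of the
   complex plane, and the derivative below is the complex one. *)
Definition Gamma (z : C^o) : C^o :=
  limn (fun n : nat => (n`!%:R * cexp (z * (ln (n%:R : R))%:C)
                        / \prod_(k < n.+1) (z + k%:R) : C^o)).

Definition digamma (z : C) : C := derive1 Gamma z / Gamma z.

Definition euler_gamma : R :=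
  limn (fun n : nat => series harmonic n - ln (n%:R : R)).

Definition S1 (z : C) : C := digamma (z + 1) + euler_gamma%:C.

Definition analytic_at (f : C -> C) (z : C) : Prop :=
  exists2 r : R, 0 < r & exists a : nat -> C,
    forall w : C, `|w| < r%:C ->
      series (fun n => a n * w ^+ n : C^o) @ \oo --> (f (z + w) : C^o).

End SpecialFunctions.

Section QCD.
Variables (R : realType) (Nf : nat).
Local Notation C := R[i].
Local Notation flavor_mx := 'M[C]_(Nf + Nf + 1).
Local Notation flavor_form := 'rV[C]_(Nf + Nf + 1).

Definition quark (i : 'I_Nf) : 'I_(Nf + Nf + 1) := lshift 1 (lshift Nf i).
Definition antiquark (i : 'I_Nf) : 'I_(Nf + Nf + 1) := lshift 1 (rshift Nf i).
Definition gluon : 'I_(Nf + Nf + 1) := rshift (Nf + Nf) ord0.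

Definition conj_mx : flavor_mx :=
  block_mx (block_mx 0 1%:M 1%:M 0) 0 0 1%:M.

Definition flavor_perm_mx (s : 'S_Nf) : flavor_mx :=
  block_mx (block_mx (perm_mx s) 0 0 (perm_mx s)) 0 0 1%:M.

(* Densities are column vectors, on which kernels act from the left; a
   combination of densities such as Sigma_+ is thus a row vector, and the row
   v *m M expresses the combination v of the components of M f in terms of the
   components of f. *)
Definition quark_form (i : 'I_Nf) : flavor_form := delta_mx 0 (quark i).
Definition antiquark_form (i : 'I_Nf) : flavor_form := delta_mx 0 (antiquark i).
Definition gluon_form : flavor_form := delta_mx 0 gluon.
Definition Sigma_p : flavor_form :=
  \sum_(i < Nf) (quark_form i + antiquark_form i).
Definition Sigma_m : flavor_form :=
  \sum_(i < Nf) (quark_form i - antiquark_form i).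

Definition CF : C := 4%:R / 3%:R.
Definition CA : C := 3%:R.
Definition TR : C := 2%:R^-1.
Definition beta0 : R := 11%:R - 2%:R / 3%:R * Nf%:R.

Definition gamma1_qq (z : C) : C :=
  2%:R * CF * (3%:R / 2%:R + (z * (z + 1))^-1 - 2%:R * S1 z).
Definition gamma1_qg (z : C) : C :=
  4%:R * Nf%:R * TR *
  ((z ^+ 2 + z + 2%:R) / (z * (z + 1) * (z + 2%:R))).
Definition gamma1_gq (z : C) : C :=
  2%:R * CF * ((z ^+ 2 + z + 2%:R) / ((z - 1) * z * (z + 1))).
Definition gamma1_gg (z : C) : C :=
  4%:R * CA * ((z * (z - 1))^-1 + ((z + 1) * (z + 2%:R))^-1 - S1 z) + beta0%:C.

Definition LO_kernel (z : C) (M : flavor_mx) : Prop :=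
  [/\ Sigma_p *m M = gamma1_qq z *: Sigma_p + gamma1_qg z *: gluon_form,
      gluon_form *m M = gamma1_gq z *: Sigma_p + gamma1_gg z *: gluon_form,
      Sigma_m *m M = gamma1_qq z *: Sigma_m,
      forall t : 'I_Nf -> C, \sum_i t i = 0 ->
        (\sum_i t i *: (quark_form i + antiquark_form i)) *m M =
        gamma1_qq z *: \sum_i t i *: (quark_form i + antiquark_form i)
    & forall t : 'I_Nf -> C, \sum_i t i = 0 ->
        (\sum_i t i *: (quark_form i - antiquark_form i)) *m M =
        gamma1_qq z *: \sum_i t i *: (quark_form i - antiquark_form i)].

Definition commutes_with_G (M : flavor_mx) : Prop :=
  comm_mx M conj_mx /\ forall s : 'S_Nf, comm_mx M (flavor_perm_mx s).

(* In what follows a series with z-dependent matrix coefficients is a function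
   F with F n z its coefficient of a_s^n at the moment z, and the moments are
   the z with c < Re z. *)
Definition dglap_kernel (c : R) (gamma : nat -> C -> flavor_mx) : Prop :=
  forall z : C, c < complex.Re z ->
    [/\ gamma 0%N z = 0, LO_kernel z (gamma 1%N z)
      & forall k, commutes_with_G (gamma k z)].

(* beta k is the coefficient beta_k in
   beta(a) = - beta_0 a^2 - beta_1 a^3 - ... *)
Definition beta_series (beta : nat -> R) : nat -> R :=
  fun n => if n is k.+2 then - beta k else 0.

(* d/dln mu^2 acts on a series in a_s(mu) by the chain rule, as
   beta(a) d/da. *)
Definition dlnmu2 (beta : nat -> R) (F : nat -> flavor_mx) : nat -> flavor_mx :=
  fun n => \sum_(j < n.+1)
    (beta_series beta j)%:C *: (F (n - j).+1 *+ (n - j).+1).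

Definition transformed_kernel (beta : nat -> R) (K gamma : nat -> flavor_mx) :
    nat -> flavor_mx :=
  fps_add (fps_mul (fps_mul K gamma) (fps_inv K))
          (fps_mul (dlnmu2 beta K) (fps_inv K)).

(* Invertibility is automatic by fps_mulV and fps_mulVr. *)
Definition scheme_transformation (c : R) (K : nat -> C -> flavor_mx) : Prop :=
  [/\ forall z : C, c < complex.Re z -> K 0%N z = 1%:M,
      forall n i j (z : C), c < complex.Re z ->
        analytic_at (fun w => K n w i j) z
    & forall n (z : C), c < complex.Re z ->
        K n (conjc z) = map_mx conjc (K n z)].

End QCD.

(* Main.v *)
Require Import Defs.
From mathcomp Require Import all_boot all_order all_algebra all_fingroup.
From mathcomp Require Import complex ring lra zify.
From mathcomp Require Import all_classical all_reals all_analysis.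

Set Implicit Arguments.
Unset Strict Implicit.
Unset Printing Implicit Defensive.

Import Order.TTheory GRing.Theory Num.Theory.
Import numFieldNormedType.Exports.

Local Open Scope ring_scope.
Local Open Scope classical_set_scope.
Local Open Scope complex_scope.

(* If K and K' first differ at order n, their difference u there satisfies
   [u, gamma^[1]] = n beta_0 u.  So u(z) = 0 unless two eigenvalues of
   gamma^[1](z) differ by exactly n beta_0.  With D = gamma_qq - gamma_gg and
   P = gamma_qg gamma_gq, such a resonance at a = n beta_0 means
   a (a + D) = P, a (a - D) = P or a^2 = D^2 + 4 P.

   Along x + N, N = 0, 1, 2, ..., some point is not resonant.  The analytic
   theory of Gamma is not needed for this: Gamma (z + 1) = z Gamma z holds
   whether or not Euler's limit converges, so S1 either obeys
   S1 (z + 1) = S1 z + 1 / (z + 1) along the whole sequence or takes a junk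
   value, the same at all its points.  In the first case D grows like the
   harmonic series while P stays bounded; in the second the resonance
   conditions are nontrivial polynomial equations in x + N.

   Hence for uncountably many x some u (x + N) vanishes, infinitely many of them
   with the same N, and the identity theorem on the half-plane gives u = 0. *)

(** * Linear algebra of the leading-order kernel *)

(** Moving [u] past a polynomial in [A] shifts the argument by [a]. Since [p] and
    [p \Po ('X + a%:P)] have no common root, a Bezout identity between them, evaluated at [A] and
    multiplied by [u], gives [u = 0]. *)
Lemma shift_intertwiner_eq0 (F : closedFieldType) (n : nat) (A u : 'M[F]_n.+1)
    (p : {poly F}) (a : F) :
  horner_mx A p = 0 -> u *m A = (A + a%:M) *m u ->
  (forall y, root p y -> ~~ root p (y + a)) -> u = 0.
Proof.
move=> pA uA noroot.
have uq (q : {poly F}) : u * horner_mx A q = horner_mx A (q \Po ('X + a%:P)) * u.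
  have shA : horner_mx A ('X + a%:P) = A + a%:M.
    by rewrite rmorphD /= horner_mx_X horner_mx_C.
  elim/poly_ind: q => [|q b IHq].
    by rewrite comp_poly0 !rmorph0 mulr0 mul0r.
  rewrite comp_polyD comp_polyM comp_polyX comp_polyC !rmorphD !rmorphM /=.
  rewrite horner_mx_X !horner_mx_C mulrDr mulrA IHq -mulrA.
  rewrite shA mulrDl -mulrA -[u * A]/(u *m A) uA.
  by congr (_ + _); rewrite -[LHS]/(u *m b%:M) scalar_mxC.
have cop : coprimep p (p \Po ('X + a%:P)).
  apply: Pdiv.ClosedField.root_coprimep => y /noroot.
  by rewrite rootE horner_comp !hornerE.
have [[q r] /= Eqr] := Bezout_eq1_coprimepP _ _ cop.
have := congr1 (fun s => horner_mx A s * u) Eqr.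
rewrite /= rmorphD !rmorphM rmorph1 mul1r /= pA mulr0 add0r -mulrA -uq pA.
by rewrite !mulr0.
Qed.

(** Two roots of the cubic differing by [a] are 0 and a root of the quadratic factor, in either
    order, or two roots of the quadratic, and then [a ^+ 2] is its discriminant. *)
Lemma quadratic_shift_common_root (F : fieldType) (D P a y : F) :
  (2 : F) != 0 -> a != 0 -> y * (y ^+ 2 + D * y - P) = 0 ->
  (y + a) * ((y + a) ^+ 2 + D * (y + a) - P) = 0 ->
  [\/ a * (a + D) = P, a * (a - D) = P | a ^+ 2 = D ^+ 2 + 4 * P].
Proof.
move=> n2 na /eqP; rewrite mulf_eq0 => /orP[/eqP->|/eqP y2] /eqP.
  rewrite add0r mulf_eq0 (negbTE na) /= => /eqP E.
  by apply: Or31; apply/eqP; rewrite -subr_eq0 -E; apply/eqP; ring.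
rewrite mulf_eq0 => /orP[/eqP ya|/eqP ya2].
  apply: Or32; apply/eqP; rewrite -subr_eq0 -y2 -(addrK a y) ya.
  by apply/eqP; ring.
have /eqP : a * (2 * y + a + D) = 0.
  by transitivity (((y + a) ^+ 2 + D * (y + a) - P) - (y ^+ 2 + D * y - P));
    [ring | rewrite y2 ya2 subrr].
rewrite mulf_eq0 (negbTE na) /= => /eqP l.
apply: Or33; apply/eqP; rewrite -subr_eq0; apply/eqP.
transitivity ((2 * y + a + D) * (a - 2 * y - D) + 4 * (y ^+ 2 + D * y - P)).
  by ring.
by rewrite l y2 mul0r mulr0 addr0.
Qed.

(* With A the leading-order kernel minus gamma_qq, the cubic is A times the
   characteristic polynomial of A on the plane spanned by Sigma_+ and g; A
   vanishes on the other sectors. *)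
Lemma cubic_shift_intertwiner_eq0 (F : closedFieldType) (n : nat)
    (A u : 'M[F]_n) (D P a : F) :
  (2 : F) != 0 -> a != 0 ->
  A *m A *m A + D *: (A *m A) - P *: A = 0 -> u *m A = (A + a%:M) *m u ->
  a * (a + D) != P -> a * (a - D) != P -> a ^+ 2 != D ^+ 2 + 4 * P -> u = 0.
Proof.
case: n A u => [|n] A u; first by move=> *; rewrite [u]flatmx0.
move=> n2 na A3 uA /eqP N1 /eqP N2 /eqP N3.
apply: (@shift_intertwiner_eq0 _ _ A u ('X ^+ 3 + D *: 'X ^+ 2 - P *: 'X) a) => //.
  rewrite -A3 rmorphB rmorphD /= !horner_mxZ !rmorphXn /= horner_mx_X.
  by rewrite exprS expr2 mulrA.
move=> y /rootP Ey; apply/negP => /rootP; move: Ey.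
rewrite !(hornerD, hornerN, hornerZ, hornerXn, hornerX) => Ey Ea.
case: (@quadratic_shift_common_root F D P a y) => //.
  by rewrite -[RHS]Ey; ring.
by rewrite -[RHS]Ea; ring.
Qed.

(** The row vectors of the sectors span flavor space, so the cubic [X] is tested on them: on the
    plane by direct computation, and on the other sectors because [A] is already zero there. *)
Lemma LO_kernel_cubic (R : realType) (Nf : nat) (z : R[i])
    (M : 'M[R[i]]_(Nf + Nf + 1)) :
  (0 < Nf)%N -> LO_kernel z M ->
  let A := M - (gamma1_qq z)%:M in
  A *m A *m A + (gamma1_qq z - gamma1_gg Nf z) *: (A *m A)
    - (gamma1_qg Nf z * gamma1_gq z) *: A = 0.
Proof.
move=> Nf0 [MSp Mg MSm Mtp Mtm] A.
set D := gamma1_qq z - gamma1_gg Nf z.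
set b := gamma1_qg Nf z; set c := gamma1_gq z.
have Arow (v : 'rV[R[i]]_(Nf + Nf + 1)) : v *m A = v *m M - gamma1_qq z *: v.
  by rewrite mulmxBr mul_mx_scalar.
have ASp : Sigma_p R Nf *m A = b *: gluon_form R Nf.
  by rewrite Arow MSp addrC addKr.
have Ag : gluon_form R Nf *m A = c *: Sigma_p R Nf - D *: gluon_form R Nf.
  by rewrite Arow Mg -addrA -scalerBl -[gamma1_gg Nf z - _]opprB scaleNr.
pose X : 'M[R[i]]_(Nf + Nf + 1) := A *m A *m A + D *: (A *m A) - (b * c) *: A.
suff: X = 0 by [].
have Xrow (v : 'rV[R[i]]_(Nf + Nf + 1)) :
    v *m X = v *m A *m A *m A + D *: (v *m A *m A) - (b * c) *: (v *m A).
  by rewrite mulmxBr mulmxDr -!scalemxAr !mulmxA.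
have X0 (v : 'rV[R[i]]_(Nf + Nf + 1)) : v *m A = 0 -> v *m X = 0.
  by move=> vA; rewrite Xrow vA !mul0mx !scaler0 addr0 subr0.
have XSp : Sigma_p R Nf *m X = 0.
  rewrite Xrow ASp -!scalemxAl Ag mulmxBl -!scalemxAl ASp Ag.
  move: (Sigma_p R Nf) (gluon_form R Nf) (D) (b) (c) => ? ? ? ? ?.
  by apply/rowP => j; rewrite !mxE; ring.
have Xg : gluon_form R Nf *m X = 0.
  rewrite Xrow Ag !mulmxBl -!scalemxAl ASp Ag !mulmxBl -!scalemxAl ASp Ag.
  move: (Sigma_p R Nf) (gluon_form R Nf) (D) (b) (c) => ? ? ? ? ?.
  by apply/rowP => j; rewrite !mxE; ring.
have XSm : Sigma_m R Nf *m X = 0.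
  by apply: X0; rewrite Arow MSm subrr.
have nNf : Nf%:R != 0 :> R[i] by rewrite pnatr_eq0 -lt0n.
(* Splits [S i] into a traceless combination, to which the hypotheses on [M] apply, and the average
   of all the [S k]. *)
have center (S : 'I_Nf -> 'rV[R[i]]_(Nf + Nf + 1)) i :
    S i = \sum_k ((k == i)%:R - Nf%:R^-1) *: S k + Nf%:R^-1 *: \sum_k S k.
  rewrite scaler_sumr -big_split /= (bigD1 i) //= big1 => [|k /negbTE ->].
    by rewrite eqxx -scalerDl subrK scale1r addr0.
  by rewrite -scalerDl subrK scale0r.
have sum0 (i : 'I_Nf) : \sum_(k < Nf) ((k == i)%:R - Nf%:R^-1) = 0 :> R[i].
  rewrite big_split /= sumr_const card_ord (bigD1 i) //= big1 => [|k /negbTE ->//].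
  by rewrite eqxx addr0 -[- _ *+ _]mulr_natr mulNr mulVf // subrr.
have Xp i : (quark_form R i + antiquark_form R i) *m X = 0.
  rewrite (center (fun i => quark_form R i + antiquark_form R i)) mulmxDl.
  rewrite -scalemxAl XSp scaler0 addr0; apply: X0.
  by rewrite Arow Mtp ?subrr.
have Xm i : (quark_form R i - antiquark_form R i) *m X = 0.
  rewrite (center (fun i => quark_form R i - antiquark_form R i)) mulmxDl.
  rewrite -scalemxAl XSm scaler0 addr0; apply: X0.
  by rewrite Arow Mtm ?subrr.
have Xq i : quark_form R i *m X = 0.
  have -> : quark_form R i = 2^-1 *: ((quark_form R i + antiquark_form R i)
      + (quark_form R i - antiquark_form R i)).
    by apply/rowP => j; rewrite !mxE; field.
  by rewrite -scalemxAl mulmxDl Xp Xm addr0 scaler0.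
have Xqb i : antiquark_form R i *m X = 0.
  rewrite -(addKr (quark_form R i) (antiquark_form R i)) mulmxDl Xp.
  by rewrite mulNmx Xq oppr0 addr0.
apply/row_matrixP => i; rewrite row0 rowE.
case: (split_ordP i) => k ->; last by rewrite (ord1 k).
by case: (split_ordP k) => l ->; [exact: Xq | exact: Xqb].
Qed.

(** * The functional equation of Gamma and the harmonic sum *)

Section Gamma.
Variable R : realType.
Local Notation C := R[i].

(** The default value of a limit is the base point, which is 0 in [C^o]. *)
Lemma dvg_lim0 (T : Type) (F : set_system T) (f : T -> C^o) :
  ~ cvg (f @ F) -> lim (f @ F) = 0.
Proof. exact: dvgP. Qed.

Lemma cexpDr (z : C) (t : R) : cexp (z + t%:C) = cexp z * (expR t)%:C.
Proof.
by case: z => a b; rewrite /cexp /=; apply/eqP; rewrite eq_complex /= !addr0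
  expRD; apply/andP; split; apply/eqP; ring.
Qed.

Definition Euler_seq (z : C) (n : nat) : C^o :=
  n`!%:R * cexp (z * (ln (n%:R : R))%:C) / \prod_(k < n.+1) (z + k%:R).

Lemma Re_pos_neq0 (z : C) : 0 < complex.Re z -> z != 0.
Proof. by apply: contraTneq => ->; rewrite ltxx. Qed.

Lemma ReDnat (z : C) (k : nat) :
  complex.Re (z + k%:R) = complex.Re z + k%:R.
Proof. by rewrite raddfD /= raddfMn. Qed.

Lemma natrC (n : nat) : (n%:R : R)%:C = n%:R :> C.
Proof. by rewrite rmorph_nat. Qed.

(** The product telescopes and the power gains a factor [n]; the remaining factor tends to [z]. *)
Lemma Euler_seq_shift (z : C) (n : nat) : 0 < complex.Re z -> (0 < n)%N ->
  Euler_seq (z + 1) n = Euler_seq z n * (z / (1 + (z + 1) * n%:R^-1)).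
Proof.
move=> z0 n0; rewrite /Euler_seq.
have zk k : z + k%:R != 0 by rewrite Re_pos_neq0 // ReDnat ltr_wpDr.
have z1k k : z + 1 + k%:R != 0 by rewrite -addrA nat1r zk.
have nn : n%:R != 0 :> C by rewrite pnatr_eq0 -lt0n.
have prodE : (\prod_(k < n.+1) (z + 1 + k%:R)) * z =
    (\prod_(k < n.+1) (z + k%:R)) * (z + 1 + n%:R) :> C.
  rewrite [X in X * z]big_ord_recr [X in _ = X * _]big_ord_recl /= addr0.
  rewrite mulrAC; congr (_ * _); rewrite mulrC; congr (_ * _).
  by apply: eq_bigr => k _; rewrite -addrA nat1r.
have prodN0 : \prod_(k < n.+1) (z + 1 + k%:R) != 0 :> C.
  by apply/prodf_neq0 => k _.
rewrite mulrDl mul1r cexpDr lnK ?posrE ?ltr0n // natrC.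
have -> : 1 + (z + 1) * n%:R^-1 = (z + 1 + n%:R) / n%:R :> C.
  by field.
have -> : \prod_(k < n.+1) (z + k%:R) =
   (\prod_(k < n.+1) (z + 1 + k%:R)) * z / (z + 1 + n%:R) :> C.
  by rewrite prodE mulfK.
field.
by rewrite z1k nn prodN0 Re_pos_neq0.
Qed.

Lemma cvg_natVC : (n%:R^-1 : C^o) @[n --> \oo] --> (0 : C^o).
Proof.
apply/cvgrPdist_lt => e; rewrite ltcE /= => /andP[/eqP eI e0].
have := near_infty_natSinv_lt (PosNum e0) => - [N _ HN].
exists N.+1 => // - [//|n] /= Nn.
have -> : n.+1%:R^-1 = ((n.+1%:R)^-1 : R)%:C :> C.
  by rewrite fmorphV /= rmorph_nat.
by rewrite sub0r normrN normc_def /= expr0n addr0 sqrtr_sqr ger0_norm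
  ?invr_ge0 // ltcE /= eI eqxx HN.
Qed.

Lemma cvg_Euler_ratio (z : C) :
  ((1 + (z + 1) * n%:R^-1) : C^o) @[n --> \oo] --> (1 : C^o).
Proof.
rewrite -[X in _ --> X]addr0 -[X in _ --> _ + X](mulr0 (z + 1)).
apply: cvgD; first exact: cvg_cst.
by apply: cvgMl_tmp; exact: cvg_natVC.
Qed.

(** The ratio of the two Euler sequences has the nonzero limit [z], so they converge or diverge
    together; if they diverge, both sides are the default value 0. *)
Lemma GammaS (z : C) : 0 < complex.Re z -> Gamma (z + 1) = z * Gamma z.
Proof.
move=> z0; have zN0 := Re_pos_neq0 z0; rewrite /Gamma -!/(Euler_seq _ _).
have cvg_fwd (l : C^o) : Euler_seq z @ \oo --> l ->
    Euler_seq (z + 1) @ \oo --> (z * l : C^o).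
  move=> zl.
  have ratio : z / (1 + (z + 1) * n%:R^-1) @[n --> \oo] --> (z / 1 : C^o).
    apply: cvgMl_tmp; apply: cvgV; first exact: oner_neq0.
    exact: cvg_Euler_ratio.
  have lim := @cvgM _ _ _ eventually_filter _ _ _ _ zl ratio.
  rewrite divr1 [l * z]mulrC in lim.
  apply: (cvg_trans _ lim); apply: near_eq_cvg.
  by exists 1%N => // n /= n0; rewrite Euler_seq_shift.
have cvg_bwd (l : C^o) : Euler_seq (z + 1) @ \oo --> l ->
    Euler_seq z @ \oo --> (l / z : C^o).
  move=> zl.
  have ratio : (1 + (z + 1) * n%:R^-1) / z @[n --> \oo] --> (1 / z : C^o).
    by apply: cvgMr_tmp; exact: cvg_Euler_ratio.
  have lim := @cvgM _ _ _ eventually_filter _ _ _ _ zl ratio; rewrite div1r in lim.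
  apply: (cvg_trans _ lim); apply: near_eq_cvg.
  exists 1%N => // n /= n0; rewrite Euler_seq_shift //.
  have nn : n%:R != 0 :> C by rewrite pnatr_eq0 -lt0n.
  have d0 : 1 + (z + 1) * n%:R^-1 != 0 :> C.
    have -> : 1 + (z + 1) * n%:R^-1 = (z + 1 + n%:R) / n%:R :> C by field.
    by rewrite mulf_neq0 ?invr_eq0 // -addrA nat1r Re_pos_neq0 // ReDnat ltr_wpDr.
  move: (1 + _) d0 (Euler_seq z n) => d d0 e.
  by field; rewrite zN0 d0.
have [/cvg_ex[l zl]|dvg] := pselect (cvg (Euler_seq z @ \oo)).
  by rewrite (cvg_lim _ zl) // (cvg_lim _ (cvg_fwd _ zl)).
have dvgS : ~ cvg (Euler_seq (z + 1) @ \oo).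
  by move=> /cvg_ex[l zl]; apply: dvg; apply/cvg_ex; exists (l / z); exact: cvg_bwd.
by rewrite [LHS](dvg_lim0 dvgS) [X in _ = _ * X](dvg_lim0 dvg) mulr0.
Qed.

Local Notation G := (@Gamma R).

Lemma near_Re_pos (z : C^o) : 0 < complex.Re z ->
  \forall w \near z, 0 < complex.Re w.
Proof.
move=> z0; have z0' : 0 < (complex.Re z)%:C by rewrite ltcE /= eqxx.
near=> w.
have : `|z - w| < (complex.Re z)%:C by near: w; exact: cvgr_dist_lt.
move=> /(le_lt_trans (normc_ge_Re _)); rewrite ltcR raddfB /= => /ltr_normlW.
by rewrite ltrBlDr ltrDl.
Unshelve. all: by end_near. Qed.

(** Carries derivability and derivatives of the shifted function at [z] to those of [f] at
    [z + 1]. *)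
Lemma derive_shift1 (f : C^o -> C^o) (z : C^o) :
  (fun h : C^o =>
     h^-1 *: (((f \o +%R^~ 1) \o shift z) (h *: 1) - (f \o +%R^~ 1) z)) =
  (fun h => h^-1 *: ((f \o shift (z + 1)) (h *: 1) - f (z + 1))).
Proof. by apply/funext => h /=; rewrite addrA. Qed.

Lemma near_GammaS (z : C^o) : 0 < complex.Re z ->
  \forall w \near z, (G \o +%R^~ 1) w = (id * G) w.
Proof. by move=> z0; near do rewrite /= GammaS //; exact: near_Re_pos.
Unshelve. all: by end_near. Qed.

(** Near [z] the functional equation makes each of the two functions the other one multiplied or
    divided by the nonvanishing variable. *)
Lemma derivable_GammaS (z : C^o) : 0 < complex.Re z ->
  derivable G (z + 1) 1 <-> derivable G z 1.
Proof.
move=> z0; rewrite {1}/derivable -derive_shift1 -/(derivable _ _ _).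
split => dG.
- have dq : derivable ((fun w : C^o => w^-1) * (G \o +%R^~ 1) : C^o -> C^o) z 1.
    apply: derivableM; last exact: dG.
    by apply: derivableV; [exact: Re_pos_neq0|exact: derivable_id].
  apply: near_eq_derivable dq; near=> w.
  have w0 : 0 < complex.Re w by near: w; exact: near_Re_pos.
  rewrite [LHS]/(w^-1 * G (w + 1)) GammaS //.
  exact: (mulKf (Re_pos_neq0 w0)).
- have dq : derivable (id * G : C^o -> C^o) z 1.
    by apply: derivableM; [exact: derivable_id|exact: dG].
  apply: near_eq_derivable dq; near=> w.
  by apply/esym; near: w; exact: near_GammaS.
Unshelve. all: by end_near. Qed.

Lemma digammaS (z : C) : 0 < complex.Re z -> derivable G z 1 -> G z != 0 ->
  digamma (z + 1) = digamma z + z^-1.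
Proof.
move=> z0 dG Gz; have zN0 := Re_pos_neq0 z0.
have dGS : derive1 G (z + 1) = G z + z * derive1 G z.
  rewrite !derive1E; transitivity ('D_1 (G \o +%R^~ 1) z).
    by rewrite /derive derive_shift1.
  transitivity ('D_1 (id * G : C^o -> C^o) z).
    exact: near_eq_derive (near_GammaS z0).
  rewrite deriveM; [|exact: derivable_id|exact: dG].
  by rewrite derive_id addrC; congr (_ + _); exact: mulr1.
rewrite /digamma dGS GammaS //.
move: (derive1 G z) (G z) Gz => g' g g0.
by field; rewrite g0 zN0.
Qed.

(** Either the derivative takes its default value 0, or the division by [G z = 0] returns 0. *)
Lemma digamma0 (z : C) : ~ (derivable G z 1 /\ G z != 0) -> digamma z = 0.
Proof.
rewrite /digamma => /not_andP[dG|/negP/negPn/eqP ->]; last by rewrite invr0 mulr0.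
by rewrite derive1E /derive dvg_lim0 ?mul0r.
Qed.

(** By the functional equation, being derivable with nonzero value is invariant under unit shifts.
    So [digammaS] applies at all the points [z + 1 + N], or [digamma] is 0 at all of them. *)
Lemma S1_dichotomy (z : C) : 0 < complex.Re z ->
  (forall N : nat, S1 (z + N%:R) = S1 z + \sum_(k < N) (z + k.+1%:R)^-1) \/
  (forall N : nat, S1 (z + N%:R) = (euler_gamma R)%:C).
Proof.
move=> z0; rewrite /S1.
have Re0 k : 0 < complex.Re (z + k%:R) by rewrite ReDnat ltr_wpDr.
have [reg|nreg] := pselect (derivable G (z + 1) 1 /\ G (z + 1) != 0).
  left => N; rewrite [RHS]addrAC; congr (_ + _).
  have regN k : derivable G (z + k.+1%:R) 1 /\ G (z + k.+1%:R) != 0.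
    elim: k => [//|k [dk Gk]]; rewrite -natr1 addrA; split.
      exact/derivable_GammaS.
    by rewrite GammaS // mulf_neq0 // Re_pos_neq0.
  elim: N => [|N IHN]; first by rewrite big_ord0 !addr0.
  have [dN GN] := regN N.
  by rewrite big_ord_recr /= addrA -IHN -(addrA z N%:R) natr1 digammaS.
right => N; rewrite digamma0 ?add0r // -addrA natr1 => regN; apply: nreg.
elim: N regN => [//|N IHN [dN GN]]; apply: IHN.
have zN := Re0 N.+1.
have E : z + N.+2%:R = z + N.+1%:R + 1 by rewrite -addrA natr1.
move: dN GN; rewrite E => /(derivable_GammaS zN) dN GN; split; first by [].
by apply: contra_neq GN => GN; rewrite GammaS // GN mulr0.
Qed.

End Gamma.

(** * Existence of nonresonant moments *)

Section Nonresonance.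
Variable R : realType.
Implicit Types (x y a k nu : R).

(** At a real moment, [D_rat] is the part of [gamma1_qq - gamma1_gg] free of [S1], with its
    constants gathered in [k], and [P_rat] is [gamma1_qg * gamma1_gq] with [nu] flavors. *)
Definition D_rat k y : R := k + 8 / 3 * (y * (y + 1))^-1
  - 12 * ((y * (y - 1))^-1 + ((y + 1) * (y + 2))^-1).
Definition P_rat nu y : R :=
  16 / 3 * nu *
  ((y ^+ 2 + y + 2) ^+ 2 / ((y - 1) * y ^+ 2 * (y + 1) ^+ 2 * (y + 2))).

(** The first [size p] shifts of [x] are distinct, one more than the degree of [p]. *)
Lemma poly_shift_nonroot (p : {poly R}) x : p != 0 ->
  exists N : nat, ~~ root p (x + N%:R).
Proof.
move=> p0; apply: contrapT => /forallNP allroot.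
have := max_poly_roots p0 (rs := [seq x + i%:R | i <- iota 0 (size p)]).
rewrite size_map size_iota ltnn => /(_ _ _)/notF; apply.
  by apply/allP => _ /mapP[i _ ->]; have /negP := allroot i; rewrite negbK.
rewrite map_inj_uniq ?iota_uniq // => i j /addrI /eqP.
by rewrite eqr_nat => /eqP.
Qed.

Lemma rational_nonresonance k nu x a : 1 < x -> 0 < nu -> 0 < a ->
  exists N : nat, let y := x + N%:R in
  [/\ a * (a + D_rat k y) != P_rat nu y, a * (a - D_rat k y) != P_rat nu y
    & a ^+ 2 != D_rat k y ^+ 2 + 4 * P_rat nu y].
Proof.
move=> x1 nu0 a0.
(* q1, q2, q3 are the resonance conditions times w^2; they are nonzero because
   D and P are singular at 0 and at 1. *)
pose w : {poly R} := ('X - 1%:P) * 'X * ('X + 1%:P) * ('X + 2%:P).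
pose Dw : {poly R} := k%:P * w + (8 / 3)%:P * (('X - 1%:P) * ('X + 2%:P))
  - 12%:P * (('X + 1%:P) * ('X + 2%:P) + ('X - 1%:P) * 'X).
pose Pw : {poly R} := (16 / 3 * nu)%:P * ('X ^+ 2 + 'X + 2%:P) ^+ 2
  * (('X - 1%:P) * ('X + 2%:P)).
pose q1 := (a ^+ 2)%:P * w ^+ 2 + a%:P * Dw * w - Pw.
pose q2 := (a ^+ 2)%:P * w ^+ 2 - a%:P * Dw * w - Pw.
pose q3 := Dw ^+ 2 + 4%:P * Pw - (a ^+ 2)%:P * w ^+ 2.
have poly_neq0 (q : {poly R}) t : q.[t] != 0 -> q != 0.
  by apply: contra_neq => ->; rewrite horner0.
have hE := (hornerD, hornerN, hornerM, hornerC, hornerX, horner_exp).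
have q0 : q1 * q2 * q3 != 0.
  rewrite !mulf_neq0 //.
  (* At 0, [w] vanishes and [Pw] is a nonzero multiple of [nu]. For [q3] the point 1 is used: there
     [w] and [Pw] vanish and [Dw] is -72. *)
  - by apply: (poly_neq0 _ 0); rewrite /q1 /Dw /Pw /w !hE; lra.
  - by apply: (poly_neq0 _ 0); rewrite /q2 /Dw /Pw /w !hE; lra.
  - by apply: (poly_neq0 _ 1); rewrite /q3 /Dw /Pw /w !hE; lra.
have [N] := poly_shift_nonroot x q0; move=> qN; exists N; move: qN.
set y := x + N%:R => /=.
have y1 : 1 < y by rewrite ltr_wpDr.
rewrite !rootM !negb_or !rootE => /andP[/andP[n1 n2] n3].
pose W := (y - 1) * y * (y + 1) * (y + 2).
have yN0 : [/\ y - 1 != 0, y != 0, y + 1 != 0 & y + 2 != 0].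
  by split; lra.
case: yN0 => ym1 y0 yp1 yp2.
have q1y : q1.[y] = (a * (a + D_rat k y) - P_rat nu y) * W ^+ 2.
  rewrite /q1 /Dw /Pw /w !hE /D_rat /P_rat /W; field.
  by rewrite ym1 y0 yp1 yp2.
have q2y : q2.[y] = (a * (a - D_rat k y) - P_rat nu y) * W ^+ 2.
  rewrite /q2 /Dw /Pw /w !hE /D_rat /P_rat /W; field.
  by rewrite ym1 y0 yp1 yp2.
have q3y : q3.[y] = (D_rat k y ^+ 2 + 4 * P_rat nu y - a ^+ 2) * W ^+ 2.
  rewrite /q3 /Dw /Pw /w !hE /D_rat /P_rat /W; field.
  by rewrite ym1 y0 yp1 yp2.
split; [move: n1|move: n2|move: n3]; apply: contra_neq => E.
- by rewrite q1y E subrr mul0r.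
- by rewrite q2y E subrr mul0r.
- by rewrite q3y E subrr mul0r.
Qed.

(** Since [x <= m + 1], each term is at least [1 / (m + 2)] times the harmonic term [1 / (k + 1)],
    and the harmonic series diverges. *)
Lemma harmonic_shift_unbounded x M : 0 <= x ->
  exists N : nat, M <= \sum_(k < N) (x + k.+1%:R)^-1.
Proof.
move=> x0; pose m := Num.truncn x.
have xm : x <= m.+1%:R by apply/ltW; rewrite truncnS_gt.
have [N MN] : exists N, M * m.+2%:R <= series (@harmonic R) N.
  apply: contrapT => /forallNP unb; apply: (@dvg_harmonic R).
  apply: nondecreasing_is_cvgn.
    by apply: nondecreasing_series => i _ _; exact: harmonic_ge0.
  exists (M * m.+2%:R) => _ [N _ <-].
  by have /negP := unb N; rewrite -ltNge => /ltW.
exists N; rewrite -(ler_pM2r (_ : 0 < m.+2%:R)) // (le_trans MN) //.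
rewrite /series /= big_mkord mulr_suml; apply: ler_sum => k _.
rewrite /harmonic mulrC ler_pdivlMr ?ltr_wpDl //.
rewrite mulrC ler_pdivrMr // (@le_trans _ _ (m.+1%:R + k.+1%:R)) ?lerD2r //.
by rewrite -natrD -natrM ler_nat; nia.
Qed.

(** Real parts suffice: the first left side exceeds [B], the second is negative, and
    [T ^+ 2 - v ^+ 2] exceeds [a ^+ 2]. *)
Lemma large_nonresonance a v T p B : 0 < a -> 0 <= p <= B ->
  a + `|v| < T -> B < a * T ->
  [/\ a%:C * (a%:C + (T +i* v)) != p%:C, a%:C * (a%:C - (T +i* v)) != p%:C
    & a%:C ^+ 2 != (T +i* v) ^+ 2 + 4 * p%:C].
Proof.
move=> a0 /andP[p0 pB] aT BT.
have /ler_normlP[v1 v2] := lexx `|v|.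
have v0 := normr_ge0 v.
have -> : (4 : R[i]) = (4 : R)%:C by rewrite rmorph_nat.
rewrite !expr2; split; rewrite eq_complex /= negb_and; apply/orP; left.
- by rewrite !mul0r subr0; nra.
- by rewrite !mul0r subr0; nra.
- by rewrite !mul0r !subr0; nra.
Qed.

Lemma gamma1_qqBgg (Nf : nat) y : 1 < y ->
  gamma1_qq y%:C - gamma1_gg Nf y%:C =
  (D_rat (4 - beta0 R Nf) y)%:C + (20 / 3)%:C * S1 y%:C.
Proof.
move=> y1; rewrite /gamma1_qq /gamma1_gg /CF /CA /D_rat.
set s := S1 _; set b := beta0 _ _.
have yC : [/\ y%:C - 1 != 0, y%:C != 0, y%:C + 1 != 0 & y%:C + 2 != 0 :> R[i]].
  by split; rewrite eq_complex /= negb_and; apply/orP; left; lra.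
case: yC => ym1 y0 yp1 yp2.
by field; rewrite ym1 y0 yp1 yp2.
Qed.

Lemma gamma1_qgMgq (Nf : nat) y : 1 < y ->
  gamma1_qg Nf y%:C * gamma1_gq y%:C = (P_rat Nf%:R y)%:C.
Proof.
move=> y1; rewrite /gamma1_qg /gamma1_gq /CF /TR /P_rat.
have yC : [/\ y%:C - 1 != 0, y%:C != 0, y%:C + 1 != 0 & y%:C + 2 != 0 :> R[i]].
  by split; rewrite eq_complex /= negb_and; apply/orP; left; lra.
case: yC => ym1 y0 yp1 yp2.
by field; rewrite ym1 y0 yp1 yp2.
Qed.

Lemma D_rat_ge k y : 2 <= y -> k - 24 <= D_rat k y.
Proof.
move=> y2; rewrite /D_rat.
have i1 : 0 <= (y * (y + 1))^-1 by rewrite invr_ge0; nra.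
have i2 : (y * (y - 1))^-1 <= 1 by rewrite invf_le1; nra.
have i3 : ((y + 1) * (y + 2))^-1 <= 1 by rewrite invf_le1; nra.
lra.
Qed.

Lemma P_rat_bounds nu y : 0 < nu -> 2 <= y -> 0 <= P_rat nu y <= 16 * nu.
Proof.
move=> nu0 y2; rewrite /P_rat; set q := (_ ^+ 2 / _).
have d0 : 0 < (y - 1) * y ^+ 2 * (y + 1) ^+ 2 * (y + 2).
  by rewrite !mulr_gt0 // ?exprn_gt0 //; lra.
have q0 : 0 <= q by rewrite divr_ge0 // ?exprn_ge0 ?ltW //; nra.
have q3 : q <= 3.
  rewrite ler_pdivrMr //.
  (* For [2 <= y] each of the two factors on the right dominates one factor [y ^+ 2 + y + 2] of the
     numerator. *)
  have -> : 3 * ((y - 1) * y ^+ 2 * (y + 1) ^+ 2 * (y + 2)) =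
    (3 * (y ^+ 3 - y)) * (y * (y ^+ 2 + 3 * y + 2)) by ring.
  rewrite expr2; apply: ler_pM; rewrite ?exprS ?expr0; nra.
by apply/andP; split; nra.
Qed.

Lemma nonresonant_shift (Nf : nat) x a : (0 < Nf)%N -> 1 < x -> 0 < a ->
  exists N : nat, let z : R[i] := (x + N%:R)%:C in
  let D := gamma1_qq z - gamma1_gg Nf z in
  let P := gamma1_qg Nf z * gamma1_gq z in
  [/\ a%:C * (a%:C + D) != P, a%:C * (a%:C - D) != P
    & a%:C ^+ 2 != D ^+ 2 + 4 * P].
Proof.
move=> Nf0 x1 a0; have nu0 : 0 < Nf%:R :> R by rewrite ltr0n.
have xN (N : nat) : (x + N%:R)%:C = x%:C + N%:R :> R[i].
  by rewrite rmorphD rmorph_nat.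
have x1N (N : nat) : 1 < x + N%:R by rewrite ltr_wpDr.
have xC : 0 < complex.Re x%:C by apply: lt_trans x1.
have [S1grow|S1cst] := S1_dichotomy xC; last first.
  have [N] := rational_nonresonance
    (4 - beta0 R Nf + 20 / 3 * euler_gamma R) x1 nu0 a0; move=> HN; exists N.
  rewrite /= gamma1_qqBgg // gamma1_qgMgq // xN S1cst.
  (* A constant [S1] is absorbed into the constant term of [D_rat]. *)
  have Dk k t y : (D_rat k y)%:C + (20 / 3)%:C * t%:C =
      (D_rat (k + 20 / 3 * t) y)%:C :> R[i].
    by rewrite -rmorphM -rmorphD /D_rat /=; congr _%:C; ring.
  have c4 : (4 : R[i]) = (4 : R)%:C by rewrite rmorph_nat.
  have [n1 n2 n3] := HN; rewrite Dk c4.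
  rewrite -!(rmorphD, rmorphB, rmorphM, rmorphXn) /=.
  by split; rewrite (inj_eq (@complexI R)).
pose s := S1 x%:C; pose B := 16 * Nf%:R : R.
pose k := 4 - beta0 R Nf.
pose v := 20 / 3 * complex.Im s.
(* [v] is the imaginary part of [D] at every shift. The real part is at least
   [k - 24 + 20 / 3 * (Re s + h)], so [h >= L] lifts it above both [a + |v|] and [B / a]. *)
pose L := a + `|v| + a^-1 * B + `|k - 24 + 20 / 3 * complex.Re s| + 1.
have [N LN] := harmonic_shift_unbounded (L : R) (ltW (lt_trans ltr01 x1)).
have L0 : 0 < L.
  by rewrite /L ltr_wpDl // !addr_ge0 ?mulr_ge0 ?invr_ge0 // ltW.
exists N; set h := \sum_(_ < _) _ in LN.
(* A sum that reaches the positive [L] is not empty, and [1 <= N] brings the moment to at least 2,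
   where the bounds on [D_rat] and [P_rat] hold. *)
have N0 : (0 < N)%N.
  rewrite lt0n; apply/eqP => N0; move: LN; rewrite /h N0 big_ord0.
  by rewrite leNgt L0.
have y2 : 2 <= x + N%:R.
  have : 1 <= N%:R :> R by rewrite ler1n.
  lra.
rewrite /= gamma1_qqBgg // gamma1_qgMgq // xN S1grow -/s.
have -> : \sum_(k < N) (x%:C + k.+1%:R)^-1 = h%:C :> R[i].
  rewrite rmorph_sum; apply: eq_bigr => i _.
  by rewrite fmorphV /= rmorphD rmorph_nat.
have -> : (D_rat (4 - beta0 R Nf) (x + N%:R))%:C + (20 / 3)%:C * (s + h%:C) =
    (D_rat k (x + N%:R) + 20 / 3 * complex.Re s + 20 / 3 * h) +i* v.
  apply/eqP; rewrite eq_complex -/k /v; case: (s) => s1 s2 /=.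
  by apply/andP; split; apply/eqP; ring.
apply: (large_nonresonance (B := B)) => //; first exact: P_rat_bounds.
  have := D_rat_ge k y2; have : 0 <= a^-1 * B by rewrite ?mulr_ge0 ?invr_ge0 // ltW.
  have := ler_norm (- (k - 24 + 20 / 3 * complex.Re s)); rewrite normrN.
  move: LN L0; rewrite /L; lra.
rewrite mulrC -ltr_pdivrMr // mulrC.
have := D_rat_ge k y2; have := normr_ge0 v.
have := ler_norm (- (k - 24 + 20 / 3 * complex.Re s)); rewrite normrN.
move: LN L0; rewrite /L; lra.
Qed.

End Nonresonance.

(** * The identity theorem on a half-plane *)

Section Identity.
Variable R : realType.
Local Notation C := R[i].
Local Notation normc := Normc.normc.

Lemma normCE (z : C) : `|z| = (normc z)%:C.
Proof. by case: z. Qed.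

Lemma normc_ge0 (z : C) : 0 <= normc z.
Proof. by case: z => a b; exact: sqrtr_ge0. Qed.

Lemma normcR (t : R) : normc t%:C = `|t|.
Proof. by rewrite /= expr0n addr0 sqrtr_sqr. Qed.

Lemma normcX (z : C) n : normc (z ^+ n) = normc z ^+ n.
Proof.
elim: n => [|n IHn]; first by rewrite !expr0 Normc.normc1.
by rewrite !exprS Normc.normcM IHn.
Qed.

Lemma cvgC_dist_lt (u : nat -> C^o) (l : C^o) (e : R) :
  u @ \oo --> l -> 0 < e ->
  exists N, forall n, (N <= n)%N -> normc (l - u n) < e.
Proof.
move=> ul e0; have e0C : 0 < e%:C by rewrite ltcR.
have /cvgrPdist_lt /(_ _ e0C) [N _ HN] := ul.
by exists N => n Nn; rewrite -ltcR -normCE; exact: HN.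
Qed.

Lemma geometric_tail_le (t : R) m k : 0 <= t -> 2 * t <= 1 ->
  \sum_(m <= j < m + k) t ^+ j <= 2 * t ^+ m.
Proof.
(* Keeping the remainder [2 * t ^+ (m + k)] on the left makes the bound inductive, as
   [t ^+ j + 2 * t ^+ j.+1 <= 2 * t ^+ j]. *)
move=> t0 t2; suff : \sum_(m <= j < m + k) t ^+ j + 2 * t ^+ (m + k) <= 2 * t ^+ m.
  by have := exprn_ge0 (m + k) t0; lra.
elim: k => [|k IHk]; first by rewrite addn0 big_geq // add0r.
rewrite addnS big_nat_recr ?leq_addr //=; apply: le_trans IHk.
by have := exprn_ge0 (m + k) t0; rewrite exprS; nra.
Qed.

(** The terms of a convergent series tend to 0, so they are eventually below 1; the finitely many
    others are bounded by their sum. *)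
Lemma pseries_coef_bound (a : nat -> C) (rho : R) (l : C^o) : 0 < rho ->
  series (fun n => a n * rho%:C ^+ n : C^o) @ \oo --> l ->
  exists2 M : R, 0 <= M & forall n, normc (a n) * rho ^+ n <= M.
Proof.
move=> rho0 al; have ca : cvgn (series (fun n => a n * rho%:C ^+ n : C^o)).
  by apply/cvg_ex; exists l.
have c0 := cvg_series_cvg_0 ca.
have [N HN] := cvgC_dist_lt c0 ltr01.
exists (1 + \sum_(j < N) normc (a j) * rho ^+ j) => [|n].
  rewrite addr_ge0 // sumr_ge0 // => j _.
  by rewrite mulr_ge0 ?normc_ge0 // exprn_ge0 // ltW.
have sum0 (P : pred 'I_N) : 0 <= \sum_(j < N | P j) normc (a j) * rho ^+ j.
  by rewrite sumr_ge0 // => j _; rewrite mulr_ge0 ?normc_ge0 // exprn_ge0 // ltW.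
have [Nn|nN] := leqP N n; last first.
  rewrite (bigD1 (Ordinal nN)) //= addrCA lerDl addr_ge0 //.
have := HN n Nn; rewrite sub0r normcN Normc.normcM normcX normcR gtr0_norm //.
move=> /ltW/le_trans; apply; rewrite lerDl; exact: sum0.
Qed.

Lemma pseries_tail_le (a : nat -> C) (w : C) (rho M : R) m n : 0 < rho ->
  (forall j, normc (a j) * rho ^+ j <= M) ->
  normc (\sum_(m <= j < n) a j * w ^+ j) <=
  \sum_(m <= j < n) M * (normc w / rho) ^+ j.
Proof.
move=> rho0 aM; elim/big_ind2: _ => [|x1 y1 x2 y2 H1 H2|j _].
- by rewrite Normc.normc0.
- by apply: le_trans (le_normcD _ _) (lerD H1 H2).
- rewrite Normc.normcM normcX expr_div_n mulrCA mulrC.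
  rewrite ler_wpM2l ?exprn_ge0 ?normc_ge0 //.
  by rewrite ler_pdivlMr ?exprn_gt0.
Qed.

(** If the coefficients below [n] vanish, then at a small zero [w] the term [a n * w ^+ n] cancels a
    tail of order [|w| ^ (n + 1)]. Hence [|a n|] is at most a constant times [|w|], and [w] can be
    taken arbitrarily small. *)
Lemma pseries_zeros_coef0 (a : nat -> C) (f : C -> C) (r : R) : 0 < r ->
  (forall w : C, `|w| < r%:C ->
     series (fun n => a n * w ^+ n : C^o) @ \oo --> (f w : C^o)) ->
  (forall e : R, 0 < e -> exists w : C, [/\ w != 0, normc w < e & f w = 0]) ->
  forall n, a n = 0.
Proof.
move=> r0 fa zeros n; elim/ltn_ind: n => n IHn.
pose rho := r / 2; have rho0 : 0 < rho by rewrite /rho; lra.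
have rhoC : `|rho%:C| < r%:C.
  by rewrite normCE ltcR normcR gtr0_norm // /rho; lra.
have [M M0 aM] := pseries_coef_bound rho0 (fa _ rhoC).
have bound (w : C) : w != 0 -> normc w < rho / 2 -> f w = 0 ->
    normc (a n) <= 2 * M / rho ^+ n.+1 * normc w.
  move=> w0 wrho fw; set t := normc w / rho.
  have nw0 : 0 < normc w.
    rewrite lt_def normc_ge0 andbT; apply: contra_neq w0 => /eqP.
    by move/eqP; exact: Normc.eq0_normc.
  have t0 : 0 <= t by rewrite divr_ge0 // ltW.
  have t2 : 2 * t <= 1 by rewrite /t mulrA ler_pdivrMr //; lra.
  have wr : `|w| < r%:C.
    by rewrite normCE ltcR; move: wrho; rewrite /rho; lra.
  have key : normc (a n) * normc w ^+ n <= 2 * M * t ^+ n.+1.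
    apply/ler_addgt0Pr => e e0.
    have [N HN] := cvgC_dist_lt (fa w wr) e0.
    have := HN (n.+1 + N)%N (leq_addl _ _).
    rewrite fw sub0r normcN /series /=.
    rewrite (@big_cat_nat _ _ _ n.+1) ?leq_addr //= big_nat_recr //= big1_seq.
      rewrite add0r; set tl := \sum_(_ <= _ < _) _ => lt_e.
      have tlM : normc tl <= 2 * M * t ^+ n.+1.
        apply: (@le_trans _ _ (\sum_(n.+1 <= j < n.+1 + N) M * t ^+ j)).
          exact: pseries_tail_le.
        rewrite -mulr_sumr -mulrA mulrCA ler_wpM2l //.
        exact: geometric_tail_le.
      rewrite -normcX -Normc.normcM.
      have -> : a n * w ^+ n = (a n * w ^+ n + tl) + - tl by rewrite addrK.
      apply: le_trans (le_normcD _ _) _; rewrite normcN addrC.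
      by apply: lerD => //; exact: ltW.
    by move=> j /=; rewrite mem_index_iota => /andP[_ jn]; rewrite IHn // mul0r.
  have wn0 : 0 < normc w ^+ n by rewrite exprn_gt0.
  rewrite -(ler_pM2r wn0); apply: le_trans key _.
  rewrite /t expr_div_n exprS le_eqVlt; apply/orP; left; apply/eqP.
  by field; rewrite expf_neq0 ?gt_eqF.
apply: Normc.eq0_normc; apply/eqP; rewrite eq_le normc_ge0 andbT.
apply/ler_addgt0Pr => e e0; rewrite add0r.
pose K := 2 * M / rho ^+ n.+1.
have K0 : 0 <= K by rewrite divr_ge0 ?mulr_ge0 ?exprn_ge0 // ltW.
(* The first bound keeps the geometric ratio [t] at most 1/2; the second gives [K * |w| <= e], also
   when [K = 0]. *)
have e1 : 0 < Num.min (rho / 2) (e / (K + 1)).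
  by rewrite lt_min !divr_gt0 //; lra.
have [w [w0 we fw]] := zeros _ e1.
move: we; rewrite lt_min => /andP[w1 w2].
apply: le_trans (bound w w0 w1 fw) _; rewrite -/K.
move: w2; rewrite ltr_pdivlMr; last lra.
by have := normc_ge0 w; nra.
Qed.

Definition limit_of_zeros (g : R -> C) (l : R) := forall e : R, 0 < e ->
  exists s, [/\ s != l, `|s - l| < e & g s = 0].

Definition vanishes_near (g : R -> C) (l : R) := exists2 e : R, 0 < e &
  forall s, `|s - l| < e -> g s = 0.

Lemma analytic_zeros (f : C -> C) (z : C) : analytic_at f z ->
  (forall e : R, 0 < e -> exists w, [/\ w != 0, normc w < e & f (z + w) = 0]) ->
  exists2 e : R, 0 < e & forall w, normc w < e -> f (z + w) = 0.
Proof.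
move=> [r r0 [a fa]] zeros; exists r => // w wr.
have a0 : forall n, a n = 0 := pseries_zeros_coef0 r0 fa zeros.
have wrC : `|w| < r%:C by rewrite normCE ltcR.
have := fa w wrC.
have -> : series (fun n => a n * w ^+ n : C^o) = cst 0.
  by apply/funext => n; rewrite /series /= big1 // => j _; rewrite a0 mul0r.
move=> lim.
have lim0 : (cst 0 : nat -> C^o) @ \oo --> (0 : C^o) by exact: cvg_cst.
exact: (cvg_unique (@norm_hausdorff _ C^o) lim lim0).
Qed.

Lemma line_shift (z d : C) (s l : R) :
  z + s%:C * d = z + l%:C * d + (s - l)%:C * d.
Proof. by rewrite rmorphB; ring. Qed.

(** Let [T] be the supremum of the [t] such that [g] vanishes on [[0, t]]. Zeros accumulate at [T]
    from the left, so [g] vanishes near [T], which contradicts the choice of [T] unless 1 has been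
    reached. *)
Lemma zeros_propagate (g : R -> C) :
  (forall t, 0 <= t <= 1 -> limit_of_zeros g t -> vanishes_near g t) ->
  vanishes_near g 0 -> g 1 = 0.
Proof.
move=> gan [e0 e00 g0].
pose S := [set t : R | 0 <= t <= 1 /\ forall s, 0 <= s <= t -> g s = 0].
have S0 : S 0.
  split=> [|s /andP[s0 s0']]; first by rewrite lexx ler01.
  by apply: g0; rewrite (_ : s = 0) ?subrr ?normr0 //; lra.
have supS : has_sup S.
  by split; [exists 0|exists 1 => t [/andP[_ t1] _]].
pose T := sup S.
have T1 : T <= 1 by apply: ge_sup; [exists 0|move=> t [/andP[_ t1] _]].
have STub t : S t -> t <= T by move=> St; exact: sup_upper_bound.
have gT s : 0 <= s < T -> g s = 0.
  move=> /andP[s0 sT]; have e : 0 < T - s by lra.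
  have [t [_ gt] st] := sup_adherent e supS.
  by apply: gt; rewrite s0 ltW //; move: st; rewrite -/T; lra.
have extend e t : 0 < e -> t <= T -> (forall s, `|s - t| < e -> g s = 0) -> 0 <= t ->
    (forall s, 0 <= s < t -> g s = 0) -> 1 <= T /\ g 1 = 0 \/ t + e / 2 <= T.
  move=> e_gt0 tT ge t0 gt.
  pose t' := Num.min 1 (t + e / 2).
  have t'1 : t' <= 1 by rewrite ge_min lexx.
  have t'2 : t' <= t + e / 2 by rewrite ge_min lexx orbT.
  have t'0 : 0 <= t' by rewrite le_min ler01 /=; lra.
  have St' : S t'.
    split=> [|s /andP[s0 st']]; first by rewrite t'0.
    have [st|ts] := ltP s t; first by apply: gt; rewrite s0.
    by apply: ge; rewrite ger0_norm; lra.
  have := STub _ St'; rewrite /t'.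
  have [le1|lt1] := leP 1 (t + e / 2); last by right.
  move=> T1'; left; split=> //; apply: (proj2 St').
  by rewrite ler01 le_min lexx le1.
have T_gt0 : 0 < T \/ g 1 = 0.
  have [||[_ ->]|] := extend e0 0 e00 (STub _ S0) g0.
  - by [].
  - by move=> s /andP[s0 s0']; exfalso; lra.
  - by right.
  - by move=> ?; left; lra.
case: T_gt0 => // T0.
have [e e_gt0 ge] : vanishes_near g T.
  apply: gan => [|e e_gt0]; first by rewrite ltW.
  (* A zero in [[0, T)] closer to [T] than [e]; it differs from [T] because [T] is positive. *)
  pose s := Num.max (T / 2) (T - e / 2).
  have sT : s < T by rewrite gt_max; apply/andP; split; lra.
  have s1 : T / 2 <= s by rewrite le_max lexx.
  have s2 : T - e / 2 <= s by rewrite le_max lexx orbT.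
  exists s; split; first by rewrite lt_eqF.
    by rewrite distrC ger0_norm; lra.
  by apply: gT; apply/andP; split; lra.
case: (extend e T e_gt0 (lexx T) ge (ltW T0) gT) => [[_ -> //]|].
by move=> ?; exfalso; lra.
Qed.

(** Accumulating zeros make [f] vanish on a disc around [l]; this propagates along the segment from
    [l] to [z], parametrized by [t] in [[0, 1]]. *)
Lemma half_plane_identity (f : C -> C) (c l : R) :
  (forall z, c < complex.Re z -> analytic_at f z) -> c < l ->
  limit_of_zeros (fun x => f x%:C) l ->
  forall z, c < complex.Re z -> f z = 0.
Proof.
move=> fan cl zeros z cz.
have [e e0 fe] : exists2 e : R, 0 < e & forall w, normc w < e -> f (l%:C + w) = 0.
  apply: analytic_zeros => [|e e0]; first exact: fan.
  have [x [xl xe fx]] := zeros e e0; exists (x - l)%:C.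
  rewrite normcR -rmorphD subrKC; split=> //.
  by apply: contra_neq xl => /complexI /eqP; rewrite subr_eq0 => /eqP.
have [->|zl] := eqVneq z l%:C.
  by rewrite -[l%:C]addr0; apply: fe; rewrite Normc.normc0.
set d := z - l%:C; have d0 : d != 0 by rewrite subr_eq0.
have nd0 : 0 < normc d.
  by rewrite lt_def normc_ge0 andbT; apply: contra_neq d0; exact: Normc.eq0_normc.
have -> : z = l%:C + 1%:C * d by rewrite mul1r subrKC.
apply: (@zeros_propagate (fun t => f (l%:C + t%:C * d))).
  move=> t /andP[t0 t1] tz.
  have [|e1|e1 e10 fe1] := @analytic_zeros f (l%:C + t%:C * d).
  (* The half-plane is convex, so it contains the segment. *)
  - apply: fan; move: cz t0 t1; rewrite /d; case: (z) => x y /= cx t0 t1.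
    rewrite !mul0r !subr0; have [->|tN0] := eqVneq t 0; first by lra.
    have tx : 0 < t * (x - c) by rewrite mulr_gt0 // ?subr_gt0 // lt_def tN0.
    have lc : 0 <= (1 - t) * (l - c) by rewrite mulr_ge0 // subr_ge0 // ltW.
    lra.
  - move=> e10; have [s [sl se fs]] := tz _ (divr_gt0 e10 nd0).
    exists ((s - t)%:C * d); split; last by rewrite -line_shift.
      rewrite mulf_neq0 //; apply: contra_neq sl => /complexI /eqP.
      by rewrite subr_eq0 => /eqP.
    by rewrite Normc.normcM normcR -ltr_pdivlMr.
  - exists (e1 / normc d) => [|s sl]; first exact: divr_gt0.
    by rewrite (line_shift _ _ s t) fe1 // Normc.normcM normcR -ltr_pdivlMr.
exists (e / normc d) => [|s sl]; first exact: divr_gt0.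
by rewrite fe // Normc.normcM normcR -ltr_pdivlMr // -[s]subr0.
Qed.

(** An interval of positive Lebesgue measure is not a countable union of finite sets, so some [Z N]
    meets it in an infinite set, which has a limit point by Bolzano-Weierstrass. *)
Lemma pigeonhole_limit_point (Z : nat -> set R) (a b : R) : a < b ->
  (forall x, a <= x <= b -> exists N, Z N x) ->
  exists N, exists2 l, a <= l & forall e : R, 0 < e ->
    exists s, [/\ s != l, `|s - l| < e & Z N s].
Proof.
move=> ab cover.
pose E N := Z N `&` [set x | a <= x <= b].
have [N infE] : exists N, infinite_set (E N).
  apply: contrapT => /forallNP fin.
  have cnt : countable (`[a, b]%classic : set R).
    have -> : (`[a, b]%classic : set R) = \bigcup_N E N.
      apply/seteqP; split => x /=; rewrite in_itv /=.
        by move=> xab; have [N ZN] := cover x xab; exists N.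
      by move=> [N _ [_]].
    apply: bigcup_countable => // N _; apply: finite_set_countable.
    by have /contrapT := fin N.
  have := countable_lebesgue_measure0 cnt.
  rewrite lebesgue_measure_itv /= lte_fin ab -EFinD => /eqP.
  by rewrite eqe subr_eq0 gt_eqF.
have bndE : bounded_set (E N).
  exists (`|a| + `|b|); split; first exact: num_real.
  move=> M ltM x [_ /andP[ax xb]]; apply: ltW; apply: le_lt_trans ltM.
  rewrite ler_norml; have := ler_norm a; have := ler_norm (- a).
  have := ler_norm b; have := ler_norm (- b); rewrite !normrN.
  have := normr_ge0 a; have := normr_ge0 b; lra.
have [l El] := infinite_bounded_limit_point_nonempty infE bndE.
have near_l e : 0 < e -> exists s, [/\ s != l, `|s - l| < e & E N s].
  move=> e0; have [y [yl Ey ye]] := El _ (nbhsx_ballx l e e0).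
  by exists y; rewrite distrC.
exists N, l => [|e e0].
  rewrite leNgt; apply/negP => la.
  have [s [_ sl [_ /andP[as_ _]]]] := near_l (a - l) ltac:(lra).
  by move: sl; rewrite ger0_norm; lra.
by have [s [sl se [Zs _]]] := near_l e e0; exists s.
Qed.

End Identity.

(** * The leading difference of two scheme transformations *)

Lemma fps_mulDl (A : pzRingType) (f g h : nat -> A) :
  fps_mul (fps_add f g) h =1 fps_add (fps_mul f h) (fps_mul g h).
Proof.
move=> n; rewrite /fps_add /fps_mul -big_split.
by apply: eq_bigr => j _; rewrite mulrDl.
Qed.

Section LeadingDifference.
Variables (R : realType) (Nf : nat).
Local Notation C := R[i].
Local Notation flavor_mx := 'M[C]_(Nf + Nf + 1).
Variable beta : nat -> R.
Implicit Types K g : nat -> flavor_mx.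

(** Clearing the inverse makes the transformation law linear in [K], so that two such laws can be
    subtracted. *)
Lemma transformed_kernelM K g : K 0%N = 1 ->
  fps_mul (transformed_kernel beta K g) K =1 fps_add (fps_mul K g) (dlnmu2 beta K).
Proof.
move=> K0 n; rewrite fps_mulDl /fps_add.
rewrite -(fps_mulA (fps_mul K g)) -(fps_mulA (dlnmu2 beta K)).
by rewrite !(eq_fps_mul (frefl _) (fps_mulVr K0)) !fps_mulr1.
Qed.

Lemma transformed_kernel0 K g : K 0%N = 1 -> g 0%N = 0 ->
  transformed_kernel beta K g 0%N = 0.
Proof.
move=> K0 g0; have := transformed_kernelM g K0 0%N.
rewrite /fps_mul /fps_add /dlnmu2 !big_ord_recl !big_ord0 /= !addr0 K0 mulr1.
by rewrite g0 mulr0 scale0r addr0.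
Qed.

(** The derivative term starts at order 2, as [beta_series] does, so the leading-order kernel is
    scheme independent. *)
Lemma transformed_kernel1 K g : K 0%N = 1 -> g 0%N = 0 ->
  transformed_kernel beta K g 1%N = g 1%N.
Proof.
move=> K0 g0; have := transformed_kernelM g K0 1%N.
rewrite /fps_mul /fps_add /dlnmu2 !big_ord_recl !big_ord0 /= !addr0.
rewrite transformed_kernel0 // mul0r add0r subnn K0 mulr1 mul1r g0 mulr0.
by rewrite !scale0r !addr0.
Qed.

(** With [T] the common kernel and [D] the difference of [K] and [K'], subtraction gives
    [T D = D g + dD/dlnmu2]. At order [n + 2] only [u] survives: it meets the order 1 terms of [T]
    and [g], both equal to [g 1], and the order 2 term of [beta_series]. *)
Lemma transformed_kernel_eq_step K K' g n :
  K 0%N = 1 -> K' 0%N = 1 -> g 0%N = 0 ->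
  transformed_kernel beta K g =1 transformed_kernel beta K' g ->
  (forall m, (m <= n)%N -> K m = K' m) ->
  let u := K n.+1 - K' n.+1 in
  u *m g 1%N = g 1%N *m u + (n.+1%:R * beta 0%N)%:C *: u.
Proof.
move=> K0 K'0 g0 eqT eqK u; pose T := transformed_kernel beta K g.
pose D j := K j - K' j.
have D0 m : (m <= n)%N -> D m = 0 by move=> mn; rewrite /D eqK ?subrr.
have key : fps_mul T D n.+2 = fps_mul D g n.+2 + dlnmu2 beta D n.+2.
  have EK := transformed_kernelM g K0 n.+2.
  have EK' := etrans (eq_fps_mul eqT (frefl K') n.+2)
    (transformed_kernelM g K'0 n.+2).
  transitivity (fps_mul T K n.+2 - fps_mul T K' n.+2).
    by rewrite /fps_mul -sumrB; apply: eq_bigr => j _; rewrite -mulrBr.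
  rewrite EK EK' /fps_add opprD addrACA; congr (_ + _).
    by rewrite /fps_mul -sumrB; apply: eq_bigr => j _; rewrite -mulrBl.
  rewrite /dlnmu2 -sumrB; apply: eq_bigr => j _.
  by rewrite -scalerBr -mulrnBl.
have lhs : fps_mul T D n.+2 = g 1%N * u.
  rewrite /fps_mul big_ord_recl big_ord_recl /= /T transformed_kernel0 //.
  rewrite transformed_kernel1 // mul0r add0r big1 => [|j _].
    by rewrite addr0 !subSS subn0.
  by rewrite D0 ?mulr0 // /bump !add1n !subSS leq_subr.
have rhs1 : fps_mul D g n.+2 = u * g 1%N.
  rewrite /fps_mul big_ord_recr big_ord_recr /= subnn g0 mulr0 addr0.
  rewrite big1 ?add0r => [|j _]; first by rewrite subSnn.
  by rewrite D0 ?mul0r // -ltnS.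
have rhs2 : dlnmu2 beta D n.+2 = - ((n.+1%:R * beta 0%N)%:C *: u).
  rewrite /dlnmu2 !big_ord_recl /= !scale0r !add0r big1 => [|j _].
    rewrite addr0 /bump /= !subSS subn0 -scaler_nat scalerA -scaleNr.
    by congr (_ *: _); rewrite rmorphN rmorphM rmorph_nat mulNr mulrC.
  rewrite D0 ?mul0rn ?scaler0 // /bump !add1n !subSS.
  by have := ltn_ord j; lia.
apply/eqP; rewrite -subr_eq; apply/eqP/esym.
by move: key; rewrite lhs rhs1 rhs2.
Qed.

Lemma resonance_free_eq0 (z : C) (M u : flavor_mx) (a : C) :
  (0 < Nf)%N -> LO_kernel z M -> a != 0 ->
  let D := gamma1_qq z - gamma1_gg Nf z in
  let P := gamma1_qg Nf z * gamma1_gq z in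
  a * (a + D) != P -> a * (a - D) != P -> a ^+ 2 != D ^+ 2 + 4 * P ->
  u *m M = M *m u + a *: u -> u = 0.
Proof.
move=> Nf0 LO a0 D P n1 n2 n3 uM.
apply: cubic_shift_intertwiner_eq0 a0 (LO_kernel_cubic Nf0 LO) _ n1 n2 n3.
  by rewrite pnatr_eq0.
rewrite mulmxBr uM !mulmxDl mulNmx !mul_scalar_mx mul_mx_scalar.
by rewrite addrAC.
Qed.

End LeadingDifference.

(** * Induction on the order in the coupling *)

Lemma analytic_atB (R : realType) (f g : R[i] -> R[i]) (z : R[i]) :
  analytic_at f z -> analytic_at g z -> analytic_at (fun w => f w - g w) z.
Proof.
move=> [r r0 [a fa]] [s s0 [b gb]].
exists (Num.min r s); first by rewrite lt_min r0.
exists (fun n => a n - b n) => w.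
rewrite normCE ltcR lt_min -!ltcR -normCE => /andP[wr ws].
have -> : series (fun n => (a n - b n) * w ^+ n : R[i]^o) =
    series (fun n => a n * w ^+ n : R[i]^o) - series (fun n => b n * w ^+ n : R[i]^o).
  apply/funext => n; rewrite fctE /series /= -sumrB.
  by apply: eq_bigr => j _; rewrite mulrBl.
by apply: cvgB; [exact: fa|exact: gb].
Qed.

Theorem theorem2 (R : realType) (Nf : nat) (beta : nat -> R) (c : R)
    (gamma K K' : nat -> R[i] -> 'M[R[i]]_(Nf + Nf + 1)) :
  (0 < Nf)%N -> beta 0%N = beta0 R Nf -> 0 < beta0 R Nf -> 1 <= c ->
  dglap_kernel c gamma ->
  scheme_transformation c K -> scheme_transformation c K' ->
  (forall (z : R[i]), c < complex.Re z -> forall n : nat,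
     transformed_kernel beta (fun k => K k z) (fun k => gamma k z) n =
     transformed_kernel beta (fun k => K' k z) (fun k => gamma k z) n) ->
  forall (z : R[i]), c < complex.Re z -> forall n : nat, K n z = K' n z.
Proof.
move=> Nf0 betaE beta_gt0 c1 kernel [K0 Kan _] [K'0 K'an _] eqT z cz n.
(* The induction hypothesis covers all moments, since the lower orders must agree at the shifted
   moments too. *)
elim/ltn_ind: n z cz => -[|n] IHn z z_gt; first by rewrite K0 // K'0.
pose a := n.+1%:R * beta 0%N.
have a0 : 0 < a by rewrite mulr_gt0 ?betaE.
pose Z N := [set x : R | K n.+1 (x + N%:R)%:C = K' n.+1 (x + N%:R)%:C].
have cN (x : R) N : c < x -> c < complex.Re (x + N%:R)%:C.
  by move=> cx; apply: lt_le_trans cx _; rewrite lerDl.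
(* The interval starts at [c + 1] so that a limit point of its points stays strictly to the right of
   [c]. *)
have cover x : c + 1 <= x <= c + 2 -> exists N, Z N x.
  move=> /andP[cx _]; have c_x : c < x by lra.
  have [N] := @nonresonant_shift _ Nf x a Nf0 (le_lt_trans c1 c_x) a0.
  move=> [n1 n2 n3]; exists N; apply/eqP; rewrite -subr_eq0; apply/eqP.
  have cz := cN x N c_x; have [g0 LO _] := kernel _ cz.
  apply: resonance_free_eq0 Nf0 LO _ n1 n2 n3 _.
    by rewrite eq_complex /= negb_and gt_eqF.
  exact: (transformed_kernel_eq_step (K0 _ cz) (K'0 _ cz) g0 (eqT _ cz)
    (fun m mn => IHn m mn _ cz)).
have [|N [l cl Zl]] := pigeonhole_limit_point _ cover; first by lra.
apply/matrixP => i j; apply/eqP; rewrite -subr_eq0; apply/eqP.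
(* Zeros of each entry accumulate at [l + N], the translate of the limit point [l] of [Z N]. *)
apply: (@half_plane_identity _ (fun w => K n.+1 w i j - K' n.+1 w i j) c
  (l + N%:R)) => //.
- by move=> w cw; apply: analytic_atB; [exact: Kan|exact: K'an].
- by apply: lt_le_trans (_ : l <= _); [lra|rewrite lerDl].
- move=> e e0; have [s [sl se Zs]] := Zl e e0.
  exists (s + N%:R); split; last by rewrite Zs subrr.
    by rewrite (inj_eq (addIr _)).
  by rewrite opprD addrACA subrr addr0.
Qed.
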